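(* Let $m\ge 2$ and let $\sigma:(0,\infty)\to(0,\infty)$ be smooth. For any eigenfunction $v_k:S^{m-1}\to\mathbb{R}$ of the Laplacian on the unit sphere $S^{m-1}$ there exist radial functions $u(r)$ such that the product $p(r,\theta)=u(r)v_k(\theta)$ is a proper biharmonic function on the model space $M^m_\sigma(o)=(\mathbb{R}^+\times S^{m-1},\, dr^2+\sigma^2(r)\,g^{S^{m-1}})$. In particular, on each of the space forms (the cases $\sigma(r)=r$ and $\sigma(r)=\sinh r$ on $0<r<\infty$, and $\sigma(r)=\sin r$ on $0<r<\pi$), for any such eigenfunction there are infinitely many proper biharmonic functions given by the product of the eigenfunction with some radial functions.
   Context: $\mathbb{R}^+=(0,\infty)$; $g^{S^{m-1}}$ is the standard metric on the unit sphere $S^{m-1}$. An eigenfunction $v_k$ on $S^{m-1}$ is a nonzero smooth function with $\Delta_{S^{m-1}}v_k=-k(m+k-2)v_k$ for some integer $k\ge0$. A radial function is a smooth function of $r$ only. With $\Delta f=\operatorname{div}(\nabla f)$, a function $f$ is biharmonic if $\Delta^2 f=\Delta(\Delta f)=0$, and proper biharmonic if it is biharmonic but not harmonic. For $\sigma(r)=\sin r$ the radial interval $(0,\infty)$ is replaced by $(0,\pi)$, so that the space is the round sphere $S^m$ minus two poles; $\sigma(r)=r$ and $\sigma(r)=\sinh r$ give $\mathbb{R}^m$ and $H^m$ minus a point. *)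

(* Defs.v *)
From HB Require Import structures.
From mathcomp Require Import all_boot all_order all_algebra.
From mathcomp Require Import all_classical all_reals all_analysis.
From mathcomp Require Import ring.

Set Implicit Arguments.
Unset Strict Implicit.
Unset Printing Implicit Defensive.

Import Order.TTheory GRing.Theory Num.Theory.
Import numFieldNormedType.Exports.

Local Open Scope classical_set_scope.
Local Open Scope ring_scope.

(* Only meant for U open, so that the values of f outside U are irrelevant. *)
Fixpoint Ck (R : realType) (V : normedModType R) (k : nat) (U : set V)
    (f : V -> R) : Prop :=
  (forall x, U x -> {for x, continuous f}) /\
  match k with
  | 0 => True
  | k'.+1 => forall v : V,
      (forall x, U x -> derivable f x v) /\ Ck k' U ('D_v f)
  end.

Definition smooth (R : realType) (V : normedModType R) (U : set V)
  (f : V -> R) : Prop := forall k, Ck k U f.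

(* Riemannian gradient, divergence and Laplacian in a coordinate domain of R^n,
   for the metric tensor with Gram matrix g x at the point of coordinates x. *)
Section Coordinates.
Context {R : realType} {n : nat}.
Implicit Types (g : 'rV[R]_n -> 'M[R]_n) (f : 'rV[R]_n -> R) (x : 'rV[R]_n).

Definition partial (i : 'I_n) f : 'rV[R]_n -> R := 'D_(delta_mx 0 i) f.

Definition gradient g f x : 'rV[R]_n :=
  \row_i \sum_j invmx (g x) i j * partial j f x.

Definition volume_density g x : R := Num.sqrt (\det (g x)).

Definition divergence g (X : 'rV[R]_n -> 'rV[R]_n) x : R :=
  (volume_density g x)^-1 *
  \sum_i partial i (fun z => volume_density g z * X z 0 i) x.

Definition laplacian g f : 'rV[R]_n -> R := divergence g (gradient g f).

End Coordinates.

Section Sphere.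
Context {R : realType}.

(* The norm `|x| of the library is the sup norm on row vectors. *)
Definition sqnorm n (x : 'rV[R]_n) : R := \sum_i x 0 i ^+ 2.

Definition sphere (d : nat) := {x : 'rV[R]_(1 + d) | sqnorm x == 1}.

(* Inverse of the stereographic projection from the pole ((-1) ^+ e, 0). *)
Definition stereo d (e : bool) (y : 'rV[R]_d) : 'rV[R]_(1 + d) :=
  row_mx ((-1) ^+ e * ((sqnorm y - 1) / (sqnorm y + 1)))%:M
         ((2 / (sqnorm y + 1)) *: y).

Lemma sqnorm_ge0 n (x : 'rV[R]_n) : 0 <= sqnorm x.
Proof. by apply: sumr_ge0 => i _; rewrite sqr_ge0. Qed.

Lemma sqnorm_row_mx d (a : R) (y : 'rV[R]_d) :
  sqnorm (row_mx a%:M y) = a ^+ 2 + sqnorm y.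
Proof.
rewrite /sqnorm big_split_ord /= big_ord1 row_mxEl mxE eqxx mulr1n.
by congr (_ + _); apply: eq_bigr => i _; rewrite row_mxEr.
Qed.

Lemma sqnormZ n (a : R) (x : 'rV[R]_n) : sqnorm (a *: x) = a ^+ 2 * sqnorm x.
Proof.
by rewrite /sqnorm mulr_sumr; apply: eq_bigr => i _; rewrite mxE exprMn.
Qed.

Lemma sqnorm_stereo d e (y : 'rV[R]_d) : sqnorm (stereo e y) == 1.
Proof.
rewrite sqnorm_row_mx sqnormZ exprMn sqrr_sign mul1r.
have N0 : sqnorm y + 1 != 0 by rewrite gt_eqF// ltr_wpDl// sqnorm_ge0.
by apply/eqP; field.
Qed.

Definition sphere_chart d (e : bool) (y : 'rV[R]_d) : sphere d :=
  exist _ (stereo e y) (sqnorm_stereo e y).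

Lemma sphere_chart_cover d (x : sphere d) :
  exists e (y : 'rV[R]_d), sphere_chart e y = x.
Proof.
case: x => x; have [a [z ->]] : exists a z, x = row_mx a%:M (z : 'rV[R]_d).
  exists ((lsubmx x : 'M[R]_1) 0 0); exists (rsubmx x).
  by rewrite -mx11_scalar hsubmxK.
move=> h.
have [e e1] : exists e : bool, (-1) ^+ e * a != 1.
  have [->|a1] := eqVneq a 1; last by exists false; rewrite mul1r.
  by exists true; rewrite mulr1 -subr_eq0 -opprD oppr_eq0 -mulr2n pnatr_eq0.
set t := (-1) ^+ e * a in e1.
have t1 : 1 - t != 0 by rewrite subr_eq0 eq_sym.
have zE : sqnorm z = 1 - t ^+ 2.
  rewrite /t exprMn sqrr_sign mul1r -(eqP h) sqnorm_row_mx.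
  by rewrite addrAC subrr add0r.
exists e, ((1 - t)^-1 *: z); apply: val_inj; rewrite /= /stereo sqnormZ zE.
have N1 : (1 - t)^-1 ^+ 2 * (1 - t ^+ 2) - 1 = 2 * t / (1 - t) by field.
have N2 : (1 - t)^-1 ^+ 2 * (1 - t ^+ 2) + 1 = 2 / (1 - t) by field.
have two : 2 != 0 :> R by rewrite pnatr_eq0.
rewrite N1 N2 scalerA; congr row_mx.
  congr (_%:M).
  have -> : 2 * t / (1 - t) / (2 / (1 - t)) = t by field; rewrite ?two ?t1.
  by rewrite /t mulrA -expr2 sqrr_sign mul1r.
have -> : 2 / (2 / (1 - t)) * (1 - t)^-1 = 1 by field; rewrite ?two ?t1.
by rewrite scale1r.
Qed.

(* Metric induced on the sphere by the Euclidean metric of R^(1 + d). *)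
Definition sphere_metric d (e : bool) (y : 'rV[R]_d) : 'M[R]_d :=
  'J (@stereo d e) y *m ('J (@stereo d e) y)^T.

(* Spherical harmonics of degree k on the unit sphere S^(m-1). *)
Definition eigenfunction (m k : nat) (v : sphere m.-1 -> R) : Prop :=
  (exists x, v x != 0) /\
  forall e : bool,
    smooth [set: 'rV[R]_m.-1] (v \o sphere_chart e) /\
    forall y, laplacian (sphere_metric e) (v \o sphere_chart e) y =
              - (k%:R * (m%:R + k%:R - 2)) * v (sphere_chart e y).

End Sphere.
Arguments sphere : clear implicits.
Arguments eigenfunction {R} m k v.

(* The model space I x S^(m-1) with the metric dr^2 + s(r)^2 g^{S^(m-1)}, for
   I an open interval.  Functions on it are represented by functions on
   R * sphere R m.-1, of which only the values on I `*` setT matter. *)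
Section ModelSpace.
Context {R : realType} (m : nat).
Implicit Types (I : set R) (s : R -> R) (p : R * sphere R m.-1 -> R).

Definition radius (x : 'rV[R]_(1 + m.-1)) : R := lsubmx x 0 0.

Definition model_chart (e : bool) (x : 'rV[R]_(1 + m.-1)) :
  R * sphere R m.-1 := (radius x, sphere_chart e (rsubmx x)).

Definition model_metric s (e : bool) (x : 'rV[R]_(1 + m.-1)) :
    'M[R]_(1 + m.-1) :=
  block_mx 1%:M 0 0 (s (radius x) ^+ 2 *: sphere_metric e (rsubmx x)).

Definition smooth_on_model I p : Prop :=
  forall e, smooth [set x | I (radius x)] (p \o model_chart e).

Definition harmonic I s p : Prop :=
  smooth_on_model I p /\
  forall e x, I (radius x) ->
    laplacian (model_metric s e) (p \o model_chart e) x = 0.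

Definition biharmonic I s p : Prop :=
  smooth_on_model I p /\
  forall e x, I (radius x) ->
    laplacian (model_metric s e)
      (laplacian (model_metric s e) (p \o model_chart e)) x = 0.

Definition proper_biharmonic I s p : Prop :=
  biharmonic I s p /\ ~ harmonic I s p.

Definition radial_product (u : R -> R) (v : sphere R m.-1 -> R) :
  R * sphere R m.-1 -> R := fun x => u x.1 * v x.2.

(* Restricting to I `*` setT identifies the products that agree there. *)
Definition proper_biharmonic_products I s (v : sphere R m.-1 -> R) :
    set (R * sphere R m.-1 -> R) :=
  [set (radial_product u v \_ (I `*` [set: sphere R m.-1]))%FUN
    | u in [set u : R -> R | smooth (I : set R^o) u /\
                             proper_biharmonic I s (radial_product u v)]].

End ModelSpace.
Arguments proper_biharmonic {R} m I s p.
Arguments proper_biharmonic_products {R} m I s v.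

Definition sinh (R : realType) (r : R) : R := (expR r - expR (- r)) / 2.

(* Main.v *)
(* In the stereographic charts the sphere metric is (2 / (|y|^2 + 1))^2 times the
   identity, so the model metric is diagonal and, with d = m - 1, lam = k (m + k - 2),
     Delta (u v_k) = (L u) v_k   where   L u = s^(-d) (s^d u')' - lam s^(-2) u.
   The equations L w = 0, w(r0) = 1 and L u = w, u(r0) = c are linear ODEs, hence
   solvable on the whole interval; then Delta^2 (u v_k) = (L w) v_k = 0 whereas
   Delta (u v_k) = w v_k is not 0.  Distinct values c give distinct products. *)
From mathcomp Require Import all_boot all_order all_algebra.
From mathcomp Require Import all_classical all_reals all_analysis.
From mathcomp Require Import ring lra.
Require Import Defs.
Import Order.TTheory GRing.Theory Num.Theory.
Import numFieldNormedType.Exports.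
Local Open Scope classical_set_scope.
Local Open Scope ring_scope.

Set Implicit Arguments.
Unset Strict Implicit.
Unset Printing Implicit Defensive.

(** The obstacle is existence on all of [I], where the coefficients may blow up at the ends, so a
    local existence theorem would not do. On a segment of [I] containing [r0] the coefficients are
    bounded by some A, and for the weight e^(2A|x - r0|) Picard iteration is a contraction. The
    iterates are defined on [I] independently of the segment, so no local solutions have to be
    glued. The second-order equation is treated as a first-order system for u and its flux s^d u',
    in whose coefficients no derivative of s occurs. Iterating the Laplacian raises a second point:
    Delta (u v_k) equals w v_k only over [I], while [laplacian] acts on functions on the whole
    coordinate space. Separation of variables is therefore stated for any function that agrees with
    a product over [I], so that it applies to Delta (u v_k) again. *)

(** * C^k calculus on open sets of a normed space *)

Section Ck_calculus.
Context {R : realType} {V : normedModType R}.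
Implicit Types (U : set V) (f g : V -> R) (k : nat).

Lemma eq_on_derivable U f g x v : open U -> U x -> (forall y, U y -> f y = g y) ->
  derivable f x v -> derivable g x v.
Proof.
move=> oU Ux fg; apply: near_eq_derivable; near=> y; apply: fg; near: y.
exact: open_nbhs_nbhs.
Unshelve. all: by end_near. Qed.

Lemma eq_on_derive U f g x v : open U -> U x -> (forall y, U y -> f y = g y) ->
  'D_v f x = 'D_v g x.
Proof.
move=> oU Ux fg; apply: near_eq_derive; near=> y; apply: fg; near: y.
exact: open_nbhs_nbhs.
Unshelve. all: by end_near. Qed.

Lemma eq_on_continuous U f g x : open U -> U x -> (forall y, U y -> f y = g y) ->
  {for x, continuous f} -> {for x, continuous g}.
Proof.
move=> oU Ux fg cf; rewrite /prop_for /continuous_at -fg//.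
apply: cvg_trans cf; apply: near_eq_cvg; near=> y; apply: fg; near: y.
exact: open_nbhs_nbhs.
Unshelve. all: by end_near. Qed.

(** Derivatives at points of an open [U] depend only on values in [U]. The rules of calculus hold
    only there, and this lemma lets the inductions replace a derivative by its formula. *)
Lemma Ck_eq k U f g : open U -> (forall x, U x -> f x = g x) ->
  Ck k U f -> Ck k U g.
Proof.
move=> oU; elim: k f g => [|k IH] f g fg [cf df]; split.
- by move=> x Ux; apply: (eq_on_continuous oU Ux fg); exact: cf.
- by [].
- by move=> x Ux; apply: (eq_on_continuous oU Ux fg); exact: cf.
move=> v; have [df1 df2] := df v; split=> [x Ux|].
  by apply: (eq_on_derivable oU Ux fg); exact: df1.
by apply: IH df2 => x Ux; exact: (eq_on_derive v oU Ux fg).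
Qed.

Lemma CkS k U f : Ck k.+1 U f -> Ck k U f.
Proof.
elim: k f => [|k IH] f [cf df]; split=> // v.
by have [df1 df2] := df v; split=> //; exact: IH.
Qed.

Lemma Ck_derivable k U f x v : Ck k.+1 U f -> U x -> derivable f x v.
Proof. by case=> _ /(_ v)[+ _]; apply. Qed.

Lemma Ck_continuous k U f x : Ck k U f -> U x -> {for x, continuous f}.
Proof. by case: k => [|k] [+ _]; apply. Qed.

Lemma Ck_derive k U f v : Ck k.+1 U f -> Ck k U ('D_v f).
Proof. by case=> _ /(_ v)[]. Qed.

Lemma Ck_cst k U (c : R) : Ck k U (cst c).
Proof.
elim: k c => [|k IH] c; split=> //; try by move=> x _; exact: cst_continuous.
move=> v; split=> [x _|]; first exact: derivable_cst.
have -> : 'D_v (cst c : V -> R) = cst 0 by apply/funext => x; rewrite derive_cst.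
exact: IH.
Qed.

Lemma CkD k U f g : open U -> Ck k U f -> Ck k U g -> Ck k U (f + g).
Proof.
move=> oU; elim: k f g => [|k IH] f g cf cg; split=> //.
- by move=> x Ux; apply: continuousD; [exact: Ck_continuous cf _|exact: Ck_continuous cg _].
- by move=> x Ux; apply: continuousD; [exact: Ck_continuous cf _|exact: Ck_continuous cg _].
move=> v; split=> [x Ux|].
  by apply: derivableD; [exact: Ck_derivable cf _|exact: Ck_derivable cg _].
apply: (@Ck_eq _ _ ('D_v f + 'D_v g)) => // [x Ux|].
  by rewrite deriveD//; [exact: Ck_derivable cf _|exact: Ck_derivable cg _].
by apply: IH; exact: Ck_derive.
Qed.

Lemma CkM k U f g : open U -> Ck k U f -> Ck k U g -> Ck k U (f * g).
Proof.
move=> oU; elim: k f g => [|k IH] f g cf cg; split=> //.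
- by move=> x Ux; apply: continuousM; [exact: Ck_continuous cf _|exact: Ck_continuous cg _].
- by move=> x Ux; apply: continuousM; [exact: Ck_continuous cf _|exact: Ck_continuous cg _].
move=> v; split=> [x Ux|].
  by apply: derivableM; [exact: Ck_derivable cf _|exact: Ck_derivable cg _].
apply: (@Ck_eq _ _ (f * 'D_v g + g * 'D_v f)) => // [x Ux|].
  by rewrite deriveM//; [exact: Ck_derivable cf _|exact: Ck_derivable cg _].
by apply: CkD => //; apply: IH; (exact: CkS || exact: Ck_derive).
Qed.

Lemma CkV k U f : open U -> (forall x, U x -> f x != 0) -> Ck k U f ->
  Ck k U (fun x => (f x)^-1).
Proof.
move=> oU f0; elim: k => [|k IH] cf; split=> //.
- by move=> x Ux; apply: continuousV; [exact: f0|exact: Ck_continuous cf _].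
- by move=> x Ux; apply: continuousV; [exact: f0|exact: Ck_continuous cf _].
move=> v; split=> [x Ux|].
  by apply: derivableV; [exact: f0|exact: Ck_derivable cf _].
(* The derivative of 1/f is -(1/f)^2 f', so order k for 1/f itself, known by induction, yields order
   k + 1. *)
have iv := IH (CkS cf).
apply: (@Ck_eq _ _ (cst (-1) *
    (((fun x => (f x)^-1) * (fun x => (f x)^-1)) * 'D_v f))) => // [x Ux|].
  rewrite deriveV//; [|exact: f0|exact: Ck_derivable cf _].
  by rewrite !fctE /= /GRing.scale/= -exprVn expr2 mulN1r mulNr.
apply: CkM => //; first exact: Ck_cst.
by apply: CkM => //; [exact: CkM|exact: Ck_derive].
Qed.

Lemma smooth_eq U f g : open U -> (forall x, U x -> f x = g x) ->
  smooth U f -> smooth U g.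
Proof. by move=> oU fg sf k; exact: Ck_eq (sf k). Qed.

Lemma smooth_cst U (c : R) : smooth U (cst c).
Proof. by move=> k; exact: Ck_cst. Qed.

Lemma smoothM U f g : open U -> smooth U f -> smooth U g -> smooth U (f * g).
Proof. by move=> oU sf sg k; exact: CkM. Qed.

Lemma smoothV U f : open U -> (forall x, U x -> f x != 0) -> smooth U f ->
  smooth U (fun x => (f x)^-1).
Proof. by move=> oU f0 sf k; exact: CkV. Qed.

Lemma smoothX U f n : open U -> smooth U f -> smooth U (fun x => f x ^+ n).
Proof.
move=> oU sf; elim: n => [|n IH]; first exact: (smooth_cst U 1).
apply: (@smooth_eq _ (f * (fun x => f x ^+ n))) => // [x _|].
  by rewrite exprS.
exact: smoothM.
Qed.

End Ck_calculus.

(** * Composition with linear maps *)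

Section derive_comp_linear.
Context {R : realType} {V W : normedModType R} (L : V -> W).
Hypothesis L_lin : forall h x v, L (h *: v + x) = h *: L v + L x.

(** By linearity the difference quotient of [f \o L] along [v] is literally that of [f] along [L v],
    hence an equality of propositions rather than an implication. *)
Lemma derivable_comp_linear (f : W -> R) x v :
  derivable (f \o L) x v = derivable f (L x) (L v).
Proof.
rewrite /derivable (_ : (fun h => _) =
  fun h => h^-1 *: ((f \o shift (L x)) (h *: L v) - f (L x)))//.
by apply/funext => h /=; rewrite L_lin.
Qed.

Lemma derive_comp_linear (f : W -> R) x v :
  'D_v (f \o L) x = 'D_(L v) f (L x).
Proof.
rewrite /derive (_ : (fun h => _) =
  fun h => h^-1 *: ((f \o shift (L x)) (h *: L v) - f (L x)))//.
by apply/funext => h /=; rewrite L_lin.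
Qed.

Lemma smooth_comp_linear U (f : W -> R) : continuous L ->
  smooth U f -> smooth (L @^-1` U) (f \o L).
Proof.
move=> cL sf k; elim: k f sf => [|k IH] f sf; split=> //.
- by move=> x Ux; apply: continuous_comp; [exact: cL|exact: Ck_continuous (sf 0) Ux].
- by move=> x Ux; apply: continuous_comp; [exact: cL|exact: Ck_continuous (sf 0) Ux].
move=> v; split=> [x Ux|].
  by rewrite derivable_comp_linear; exact: Ck_derivable (sf 1) Ux.
have -> : 'D_v (f \o L) = 'D_(L v) f \o L.
  by apply/funext => x; exact: derive_comp_linear.
by apply: IH => j; exact: Ck_derive.
Qed.

End derive_comp_linear.

(** * Smoothness of functions of one real variable, from their derivatives *)

Section smooth_real.
Context {R : realType}.
Implicit Types (U : set R) (f g : R -> R).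

(** [Ck] asks for every direction [v], even on the line, whereas differential equations give the
    derivative in direction 1. *)
Lemma is_derive_dir f (x v df : R) : is_derive x 1 f df -> is_derive x v f (v * df).
Proof.
move=> [d <-]; have /derivable1_diffP d' := d.
have E : 'D_v f x = v * 'D_1 f x.
  by rewrite !deriveE// -{1}[v]mulr1 [v * 1]/(v *: (1 : R)) linearZ.
by constructor; [exact: diff_derivable|exact: E].
Qed.

Lemma is_derive1_continuous f (x df : R) : is_derive x 1 f df -> {for x, continuous f}.
Proof. by case=> /derivable1_diffP d _; exact: differentiable_continuous. Qed.

Lemma Ck_primitive k U f g : open U -> (forall x, U x -> is_derive x 1 f (g x)) ->
  Ck k (U : set R^o) g -> Ck k.+1 (U : set R^o) f.
Proof.
move=> oU df cg; split=> [x Ux|v]; first exact: is_derive1_continuous (df x Ux).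
split=> [x Ux|]; first by case: (is_derive_dir v (df x Ux)).
apply: (@Ck_eq _ _ _ _ (cst v * g)) => // [x Ux|].
  by case: (is_derive_dir v (df x Ux)).
by apply: CkM => //; exact: Ck_cst.
Qed.

Lemma smooth_primitive U f g : open U -> (forall x, U x -> is_derive x 1 f (g x)) ->
  smooth (U : set R^o) g -> smooth (U : set R^o) f.
Proof. by move=> oU df sg k; apply: CkS; exact: Ck_primitive. Qed.

(* Bootstrapping: [y b] is C^(k+1) as soon as [y (~~ b)] is C^k. *)
Lemma smooth_system U (y a c : bool -> R -> R) : open U ->
  (forall b, smooth (U : set R^o) (a b)) -> (forall b, smooth (U : set R^o) (c b)) ->
  (forall b x, U x -> is_derive x 1 (y b) (a b x * y (~~ b) x + c b x)) ->
  forall b, smooth (U : set R^o) (y b).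
Proof.
move=> oU sa sc dy b k; elim: k b => [|k IH] b.
  by split=> // x Ux; exact: is_derive1_continuous (dy b x Ux).
apply: (@Ck_primitive _ _ _ (a b * y (~~ b) + c b)) => //.
by apply: CkD => //; [apply: CkM => //; exact: sa|exact: sc].
Qed.

End smooth_real.

(** * Primitives and exponential bounds on an open interval *)

Section linear_system.
Context {R : realType} (I : set R) (r0 : R).
Hypotheses (oI : open I) (iI : is_interval I) (Ir0 : I r0).
Notation mu := (@lebesgue_measure R).

(** Supplies the compact segments for all estimates: both [x] and the base point are interior, so
    bounds on the segment also hold near [x]. *)
Lemma segment_in_open x : I x -> exists a b,
  [/\ I a /\ I b, a < x, x < b, a < r0 & r0 < b].
Proof.
move=> Ix.
have ends y : I y -> exists2 e, 0 < e & I (y - e) /\ I (y + e).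
  move=> Iy; have /nbhs_ballP[e /= e0 eI] : nbhs y I by exact: open_nbhs_nbhs.
  exists (e / 2); first by rewrite divr_gt0.
  have e2 : `|e / 2| < e by rewrite gtr0_norm ?divr_gt0//; lra.
  split; apply: eI; rewrite -ball_normE /=.
    by rewrite (_ : y - _ = e / 2)//; ring.
  by rewrite (_ : y - _ = - (e / 2)) ?normrN//; ring.
have [e e0 [Ixm Ixp]] := ends x Ix; have [d d0 [Irm Irp]] := ends r0 Ir0.
have mI y z : I y -> I z -> I (Num.min y z) by rewrite minElt; case: ifP.
have MI y z : I y -> I z -> I (Num.max y z) by rewrite maxElt; case: ifP.
exists (Num.min (x - e) (r0 - d)), (Num.max (x + e) (r0 + d)); split.
- by split; [exact: mI|exact: MI].
- by rewrite gt_min gtrBl e0.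
- by rewrite lt_max ltrDl e0.
- by rewrite gt_min [X in _ || X]gtrBl d0 orbT.
- by rewrite lt_max [X in _ || X]ltrDl d0 orbT.
Qed.

Lemma segment_sub a b x : I a -> I b -> a <= x <= b -> I x.
Proof. by move=> Ia Ib; exact: iI. Qed.

Lemma within_segment_continuous (f : R -> R) a b : I a -> I b ->
  (forall x, I x -> {for x, continuous f}) -> {within `[a, b], continuous f}.
Proof.
move=> Ia Ib cf; apply: continuous_in_subspaceT => x /[!inE] /= /[!in_itv] /= xab.
by apply: cf; exact: segment_sub xab.
Qed.

Lemma primitive_exists (f : R -> R) : (forall x, I x -> {for x, continuous f}) ->
  exists F : R -> R, F r0 = 0 /\ forall x, I x -> is_derive x 1 F (f x).
Proof.
move=> cf.
(* The oriented integral from [r0] to [y]: at least one term is over an empty set or a single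
   point. *)
pose F y := \int[mu]_(t in `[r0, y]) f t - \int[mu]_(t in `[y, r0]) f t.
have int0 a b : b <= a -> \int[mu]_(t in `[a, b]) f t = 0.
  rewrite le_eqVlt => /predU1P[->|ba]; first by rewrite set_itv1 Rintegral_set1.
  by rewrite set_itv_ge ?Rintegral_set0// bnd_simp -ltNge.
have int a b : I a -> I b -> mu.-integrable `[a, b] (EFin \o f).
  move=> Ia Ib; apply: continuous_compact_integrable; first exact: segment_compact.
  exact: within_segment_continuous.
have chasles a b c : I a -> I c -> a <= b <= c ->
    \int[mu]_(t in `[b, c]) f t =
    \int[mu]_(t in `[a, c]) f t - \int[mu]_(t in `[a, b]) f t.
  move=> Ia Ic abc; have Ib := segment_sub Ia Ic abc.
  move: abc => /andP[ab bc].
  rewrite Rintegral_itvB ?bnd_simp//; last exact: int.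
  rewrite Rintegral_itv_obnd_cbnd//.
  apply: integrableS (int _ _ Ib Ic) => //.
  by apply: subset_itvr; rewrite bnd_simp.
exists F; split; first by rewrite /F subrr.
move=> x Ix; have [a [b [[Ia Ib] ax xb ar rb]]] := segment_in_open Ix.
have [d dE] := continuous_FTC1_closed xb (int _ _ Ia Ib) ax (cf _ Ix).
(* Near [x], [F] differs by a constant from the integral with fixed lower end a < x, to which the
   fundamental theorem applies on either side of [r0]. *)
suff FE : \forall y \near x,
    \int[mu]_(t in `[a, y]) f t - \int[mu]_(t in `[a, r0]) f t = F y.
  apply: near_eq_is_derive FE _.
  rewrite -[f x]subr0 -dE derive1E; apply: is_deriveB; first exact/derivableP.
near=> y.
have /[!in_itv]/= /andP[ay yb] : y \in `]a, b[%R.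
  by near: y; apply: near_in_itvoo; rewrite in_itv/= ax.
have Iy : I y by apply: (segment_sub Ia Ib); rewrite !ltW.
rewrite /F; have [ry|yr] := leP r0 y.
  by rewrite (int0 y r0)// subr0 (chasles a r0 y)// ry ltW.
by rewrite (int0 r0 y) ?(ltW yr)// sub0r (chasles a y r0)// ?opprB// !ltW.
Unshelve. all: by end_near. Qed.

(** The majorant has derivative C e^(B|t - r0|) away from [r0], so by the mean value theorem the
    majorant minus F, or plus F, is at least its value C / B at [r0]. *)
Lemma exp_growth_bound (F f : R -> R) (p q C B : R) : 0 < B -> 0 <= C ->
  p <= r0 <= q -> F r0 = 0 ->
  (forall t, p <= t <= q -> is_derive t 1 F (f t)) ->
  (forall t, p <= t <= q -> `|f t| <= C * expR (B * `|t - r0|)) ->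
  forall x, p <= x <= q -> `|F x| <= C / B * expR (B * `|x - r0|).
Proof.
move=> B0 C0 /andP[pr rq] F0 dF fC.
(* The sign [e] selects the side of [r0] and, further on, [s] the sign of [F]: one monotonicity
   argument covers the four cases. *)
have half (e T : R) : `|e| = 1 -> 0 <= T -> p <= r0 + e * T <= q ->
    `|F (r0 + e * T)| <= C / B * expR (B * T).
  move=> e1 T0 rT.
  have eT t : 0 <= t <= T -> p <= r0 + e * t <= q.
    move=> /andP[t0 tT]; move: e1 rT; have [e0|e0] := leP 0 e.
      by rewrite ger0_norm// => ->; lra.
    by rewrite ltr0_norm// => /eqP; rewrite eqr_oppLR => /eqP->; lra.
  suff main (s : R) : `|s| = 1 -> s * F (r0 + e * T) <= C / B * expR (B * T).
    rewrite ler_norml lerNl -mulN1r main ?normrN1//=.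
    by rewrite -[leLHS]mul1r main ?normr1.
  move=> s1; pose h t := C / B * expR (B * t) - s * F (r0 + e * t).
  pose h' t := C * expR (B * t) - s * (e * f (r0 + e * t)).
  have dh t : 0 <= t <= T -> is_derive t 1 h (h' t).
    move=> /eT pt; have dFt := dF _ pt.
    have dB (a : R) : is_derive t 1 (fun t : R => a * t) a.
      by have := is_deriveZ a (is_derive_id t (1 : R)); rewrite /GRing.scale/= mulr1.
    have dE : is_derive t 1 (fun t : R => expR (B * t)) (expR (B * t) * B).
      exact: (is_derive1_comp (is_derive_expR _) (dB B)).
    have dr : is_derive t 1 (fun t => r0 + e * t) e.
      by have := is_deriveD (is_derive_cst r0 t 1) (dB e); rewrite add0r.
    have dFr : is_derive t 1 (fun t => F (r0 + e * t)) (f (r0 + e * t) * e).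
      exact: (@is_derive1_comp _ F (fun t => r0 + e * t) t _ _ dFt dr).
    have := is_deriveB (is_deriveZ (C / B) dE) (is_deriveZ s dFr).
    have -> : (C / B) *: (expR (B * t) * B) - s *: (f (r0 + e * t) * e) = h' t.
      by rewrite /h' /GRing.scale/=; field; rewrite gt_eqF.
    exact.
  have [c cT hE] : exists2 c, c \in `[0, T]%R & h T - h 0 = h' c * (T - 0).
    apply: (MVT_segment T0).
      by move=> t /[!in_itv]/= /andP[t0 tT]; apply: dh; rewrite !ltW.
    apply: derivable_within_continuous => t /[!in_itv]/= tT.
    by case: (dh t tT).
  rewrite in_itv/= in cT.
  have h'c : 0 <= h' c.
    rewrite subr_ge0 (le_trans (ler_norm _))// !normrM s1 e1 !mul1r.
    rewrite (le_trans (fC _ (eT _ cT)))// addrAC subrr add0r normrM e1 mul1r.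
    by rewrite ger0_norm//; case/andP: cT.
  have : 0 <= h T - h 0 by rewrite hE subr0 mulr_ge0.
  rewrite /h !mulr0 addr0 F0 mulr0 expR0 mulr1 subr0.
  have : 0 <= C / B by rewrite divr_ge0// ltW.
  lra.
move=> x /andP[px xq]; have [rx|xr] := leP r0 x.
  have -> : x = r0 + 1 * (x - r0) by ring.
  have -> : r0 + 1 * (x - r0) - r0 = x - r0 by ring.
  rewrite [`|x - r0|]ger0_norm ?subr_ge0//; apply: (half 1); rewrite ?normr1 ?subr_ge0//.
  by rewrite mul1r addrC subrK px.
have -> : x = r0 + -1 * (r0 - x) by ring.
have -> : r0 + -1 * (r0 - x) - r0 = - (r0 - x) by ring.
rewrite normrN [`|r0 - x|]ger0_norm ?subr_ge0 ?(ltW xr)//; apply: (half (-1)).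
- by rewrite normrN1.
- by rewrite subr_ge0 ltW.
- by rewrite mulN1r opprB addrC subrK px.
Qed.

End linear_system.

(** * Picard iteration for a linear system of two equations *)

Section picard.
Context {R : realType} (I : set R) (r0 : R).
Hypotheses (oI : open I) (iI : is_interval I) (Ir0 : I r0).
Variables (a g : bool -> R -> R) (c : bool -> R).
Hypotheses (ca : forall b x, I x -> {for x, continuous (a b)})
  (cg : forall b x, I x -> {for x, continuous (g b)}).
(** Integration from [r0], as an operator on all functions so that it can be iterated before
    continuity of the iterates is proved. *)
Variable P : (R -> R) -> R -> R.
Hypotheses (P0 : forall f, P f r0 = 0)
  (dP : forall f, (forall x, I x -> {for x, continuous f}) ->
    forall x, I x -> is_derive x 1 (P f) (f x)).

Fixpoint picard (n : nat) (b : bool) : R -> R :=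
  if n is n'.+1 then fun x => c b + P (fun t => a b t * picard n' (~~ b) t + g b t) x
  else cst 0.

Lemma is_derive_picard_step (y : bool -> R -> R) b x :
  (forall b x, I x -> {for x, continuous (y b)}) -> I x ->
  is_derive x 1 (fun x => c b + P (fun t => a b t * y (~~ b) t + g b t) x)
    (a b x * y (~~ b) x + g b x).
Proof.
move=> cy Ix.
have dPx : is_derive x 1 (P (fun t => a b t * y (~~ b) t + g b t))
    (a b x * y (~~ b) x + g b x).
  apply: dP => // z Iz.
  by apply: continuousD; [apply: continuousM; [exact: ca|exact: cy]|exact: cg].
by have := is_deriveD (is_derive_cst (c b) x (1 : R)) dPx; rewrite add0r.
Qed.

Lemma picard_continuous n b x : I x -> {for x, continuous (picard n b)}.
Proof.
elim: n b x => [|n IH] b x Ix; first exact: cst_continuous.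
exact: is_derive1_continuous (is_derive_picard_step b IH Ix).
Qed.

Lemma is_derive_picard n b x : I x ->
  is_derive x 1 (picard n.+1 b) (a b x * picard n (~~ b) x + g b x).
Proof. by move=> Ix; apply: is_derive_picard_step => // *; exact: picard_continuous. Qed.

Lemma segment_bound (f : bool -> R -> R) p q : I p -> I q -> p <= q ->
  (forall b x, I x -> {for x, continuous (f b)}) ->
  exists2 M, 0 < M & forall b x, p <= x <= q -> `|f b x| <= M.
Proof.
move=> Ip Iq pq cf.
have bnd b : exists M, forall x, p <= x <= q -> `|f b x| <= M.
  have cn : {within `[p, q], continuous (fun x => `|f b x|)}.
    apply: (within_segment_continuous iI Ip Iq) => x Ix.
    by apply: continuous_comp; [exact: cf|exact: norm_continuous].
  have [z _ zM] := EVT_max pq cn.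
  by exists `|f b z| => x xpq; apply: zM; rewrite in_itv.
have [M0 M0P] := bnd false; have [M1 M1P] := bnd true.
exists (`|M0| + `|M1| + 1); first by have := normr_ge0 M0; have := normr_ge0 M1; lra.
move=> [] x xpq.
  have := M1P _ xpq; have := ler_norm M1; have := normr_ge0 M0; lra.
have := M0P _ xpq; have := ler_norm M0; have := normr_ge0 M1; lra.
Qed.

(** The terms [c] and [g] cancel between iterates: after the first, each increment vanishes at [r0]
    and has derivative [a] times the previous increment of the other component. *)
Lemma picard_increment p q : I p -> I q -> p <= r0 <= q ->
  exists2 K, 0 < K & forall n b x, p <= x <= q ->
    `|picard n.+1 b x - picard n b x| <= K / 2 ^+ n.
Proof.
move=> Ip Iq prq; have /andP[pr rq] := prq; have pq := le_trans pr rq.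
have [A A0 aA] := segment_bound Ip Iq pq ca.
have cd b x : I x -> {for x, continuous (fun x => picard 1 b x - picard 0 b x)}.
  by move=> Ix; apply: continuousB; exact: picard_continuous.
have [D D0 dD] := segment_bound Ip Iq pq cd.
(* For this weight, which Picard iteration contracts by 1/2, no factorials are needed. *)
have main n b x : p <= x <= q ->
    `|picard n.+1 b x - picard n b x| <= D / 2 ^+ n * expR (2 * A * `|x - r0|).
  elim: n b x => [|n IH] b x xpq.
    rewrite expr0 divr1 (le_trans (dD b x xpq))// ler_peMr ?(ltW D0)//.
    by rewrite -expR0 ler_expR !mulr_ge0// ltW.
  (* The coefficient costs a factor A and integrating the weight gains 1 / (2A), whence the ratio
     1/2. *)
  have -> : D / 2 ^+ n.+1 = A * (D / 2 ^+ n) / (2 * A).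
    by rewrite exprS; field; rewrite gt_eqF//= expf_neq0.
  apply: (@exp_growth_bound _ r0 (fun x => picard n.+2 b x - picard n.+1 b x)
    (fun t => a b t * (picard n.+1 (~~ b) t - picard n (~~ b) t)) p q) => //.
  - by rewrite mulr_gt0.
  - by rewrite mulr_ge0 ?divr_ge0 ?exprn_ge0 ?ltW.
  - by rewrite /= !P0 subrr.
  - move=> t tpq; have It : I t := segment_sub iI Ip Iq tpq.
    have := is_deriveB (is_derive_picard n.+1 b It) (is_derive_picard n b It).
    rewrite (_ : _ - _ = a b t * (picard n.+1 (~~ b) t - picard n (~~ b) t)); last by ring.
    exact.
  move=> t tpq; rewrite normrM -mulrA ler_pM//; first exact: aA.
  exact: IH.
exists (D * expR (2 * A * (q - p))); first by rewrite mulr_gt0// expR_gt0.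
move=> n b x xpq; rewrite (le_trans (main n b x xpq))// mulrAC.
rewrite ler_pM2r ?invr_gt0 ?exprn_gt0// ler_pM2l// ler_expR ler_pM2l ?mulr_gt0//.
by rewrite ler_norml; move: xpq => /andP[px xq]; apply/andP; split; lra.
Qed.

Lemma picard_tail p q : I p -> I q -> p <= r0 <= q ->
  exists2 K, 0 < K & forall n k b x, p <= x <= q ->
    `|picard (n + k) b x - picard n b x| <= K / 2 ^+ n.
Proof.
move=> Ip Iq prq; have [K K0 KP] := picard_increment Ip Iq prq.
exists (2 * K) => [|n k b x xpq]; first by rewrite mulr_gt0.
elim: k n => [|k IH] n; first by rewrite addn0 subrr normr0 divr_ge0 ?exprn_ge0 ?mulr_ge0 ?ltW.
(* Peeling off the first increment, not the last, reproduces the geometric tail 2K / 2^n with a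
   bound free of [k]. *)
have -> : picard (n + k.+1) b x - picard n b x =
    (picard (n.+1 + k) b x - picard n.+1 b x) + (picard n.+1 b x - picard n b x).
  by rewrite addSnnS addrA subrK.
rewrite (le_trans (ler_normD _ _))//.
have -> : 2 * K / 2 ^+ n = 2 * K / 2 ^+ n.+1 + K / 2 ^+ n.
  by rewrite exprS; field; rewrite expf_neq0.
by apply: lerD; [exact: IH|exact: KP].
Qed.

Lemma half_pow_lt (K e : R) : 0 < e -> exists n, K / 2 ^+ n < e.
Proof.
move=> e0; have : K / 2 ^+ n @[n --> \oo] --> (0 : R).
  rewrite -(mulr0 K); apply: cvgM; first exact: cvg_cst.
  under eq_fun do rewrite -exprVn.
  by apply: cvg_expr; rewrite ger0_norm// invf_lt1// ltr1n.
move=> /cvgrPdist_lt/(_ _ e0)[n _ /(_ n (leqnn n))]/=.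
by rewrite sub0r normrN => ne; exists n; exact: le_lt_trans (ler_norm _) ne.
Qed.

Definition picard_lim b x := limn (fun n => picard n b x).

Lemma picard_cvg b x : I x -> picard n b x @[n --> \oo] --> picard_lim b x.
Proof.
move=> Ix; have [p [q [[Ip Iq] px xq pr rq]]] := segment_in_open oI Ir0 Ix.
have [|K K0 KP] := picard_tail Ip Iq; first by rewrite !ltW.
apply/cauchy_cvgP/cauchy_exP => e e0; have [n ne] := half_pow_lt K e0.
exists (picard n b x); exists n => // m /= nm.
rewrite -ball_normE /= distrC (le_lt_trans _ ne)//.
by rewrite -(subnKC nm); apply: KP; rewrite !ltW.
Qed.

Lemma picard_lim_dist p q : I p -> I q -> p <= r0 <= q ->
  exists2 K, 0 < K & forall n b x, p <= x <= q ->
    `|picard_lim b x - picard n b x| <= K / 2 ^+ n.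
Proof.
move=> Ip Iq prq; have [K K0 KP] := picard_tail Ip Iq prq.
exists K => // n b x xpq; have Ix : I x := segment_sub iI Ip Iq xpq.
have cd : `|picard m b x - picard n b x| @[m --> \oo] --> `|picard_lim b x - picard n b x|.
  by apply: cvg_norm; apply: cvgB; [exact: picard_cvg|exact: cvg_cst].
rewrite -(cvg_lim _ cd)//; apply: limr_le; first by apply/cvg_ex; eexists; exact: cd.
by exists n => // m /= nm; rewrite -(subnKC nm); exact: KP.
Qed.

(** A uniform limit of continuous functions, by the usual three thirds of epsilon. *)
Lemma picard_lim_continuous b x : I x -> {for x, continuous (picard_lim b)}.
Proof.
move=> Ix; have [p [q [[Ip Iq] px xq pr rq]]] := segment_in_open oI Ir0 Ix.
have [|K K0 KP] := picard_lim_dist Ip Iq; first by rewrite !ltW.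
apply/cvgrPdist_lt => e e0; have e3 : 0 < e / 3 by rewrite divr_gt0.
have [n ne] := half_pow_lt K e3.
have /cvgrPdist_lt/(_ _ e3) cn := @picard_continuous n b x Ix.
near=> y.
have /[!in_itv]/= /andP[py yq] : y \in `]p, q[%R.
  by near: y; apply: near_in_itvoo; rewrite in_itv/= px.
have dxy : `|picard n b x - picard n b y| < e / 3 by near: y; exact: cn.
have Kx := le_lt_trans (KP n b x _) ne; have Ky := le_lt_trans (KP n b y _) ne.
have {}Kx := Kx _; move: (Kx ltac:(rewrite !ltW//)) (Ky ltac:(rewrite !ltW//)) dxy.
rewrite !ltr_norml => /andP[? ?] /andP[? ?] /andP[? ?]; apply/andP; split; lra.
Unshelve. all: by end_near. Qed.

(** Instead of passing to the limit under the integral, both sides are shown to be limits of the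
    same sequence [picard n.+1 b x]. *)
Lemma picard_lim_fixed b x : I x ->
  c b + P (fun t => a b t * picard_lim (~~ b) t + g b t) x = picard_lim b x.
Proof.
move=> Ix; pose Z x := c b + P (fun t => a b t * picard_lim (~~ b) t + g b t) x.
have [p [q [[Ip Iq] px xq pr rq]]] := segment_in_open oI Ir0 Ix.
have prq : p <= r0 <= q by rewrite !ltW.
have xpq : p <= x <= q by rewrite !ltW.
have [K K0 KP] := picard_lim_dist Ip Iq prq.
have [A A0 aA] := segment_bound Ip Iq (ltW (lt_trans px xq)) ca.
(* Here the derivative has a constant bound, which is below the same constant times e^|t - r0|; the
   rate 1 is an arbitrary positive choice. *)
have main n : `|Z x - picard n.+1 b x| <= A * (K / 2 ^+ n) / 1 * expR (1 * `|x - r0|).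
  apply: (@exp_growth_bound _ r0 (fun x => Z x - picard n.+1 b x)
    (fun t => a b t * (picard_lim (~~ b) t - picard n (~~ b) t)) p q) => //.
  - by rewrite mulr_ge0 ?divr_ge0 ?exprn_ge0 ?ltW.
  - by rewrite /Z /= !P0 subrr.
  - move=> t tpq; have It : I t := segment_sub iI Ip Iq tpq.
    have := is_deriveB (is_derive_picard_step b picard_lim_continuous It)
      (is_derive_picard n b It).
    rewrite (_ : _ - _ = a b t * (picard_lim (~~ b) t - picard n (~~ b) t)); last by ring.
    exact.
  move=> t tpq; rewrite -[leLHS]mulr1 ler_pM ?normr_ge0//.
    by rewrite normrM ler_pM//; [exact: aA|exact: KP].
  by rewrite mul1r -expR0 ler_expR.
apply/eqP; rewrite -subr_eq0 -normr_le0; apply/ler_addgt0Pr => e e0; rewrite add0r.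
pose M := A * K * expR `|x - r0| + K.
have [n ne] := half_pow_lt M e0.
rewrite (le_trans _ (ltW ne))//.
have -> : Z x - picard_lim b x =
    (Z x - picard n.+1 b x) - (picard_lim b x - picard n.+1 b x) by ring.
rewrite (le_trans (ler_normB _ _))// /M mulrDl lerD//.
  by have := main n; rewrite mul1r divr1 mulrA [A * K / _ * _]mulrAC.
rewrite (le_trans (KP n.+1 b x xpq))// ler_pM2l// lef_pV2 ?posrE ?exprn_gt0//.
by rewrite ler_eXn2l// ltr1n.
Qed.

End picard.

Lemma linear_system_exists {R : realType} (I : set R) (r0 : R)
    (a g : bool -> R -> R) (c : bool -> R) :
  open I -> is_interval I -> I r0 ->
  (forall b x, I x -> {for x, continuous (a b)}) ->
  (forall b x, I x -> {for x, continuous (g b)}) ->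
  exists y : bool -> R -> R, (forall b, y b r0 = c b) /\
    forall b x, I x -> is_derive x 1 (y b) (a b x * y (~~ b) x + g b x).
Proof.
move=> oI iI Ir0 ca cg.
have ex (f : R -> R) : exists F : R -> R, F r0 = 0 /\
    ((forall x, I x -> {for x, continuous f}) -> forall x, I x -> is_derive x 1 F (f x)).
  have [cf|ncf] := pselect (forall x, I x -> {for x, continuous f}).
    by have [F [F0 dF]] := primitive_exists oI iI Ir0 cf; exists F.
  (* A default value for integrands not continuous on [I]; it still vanishes at [r0], as [P0]
     demands of every integrand. *)
  by exists (cst 0).
have [P PP] := choice ex.
have P0 f : P f r0 = 0 by case: (PP f).
have dP f : (forall x, I x -> {for x, continuous f}) ->
    forall x, I x -> is_derive x 1 (P f) (f x) by case: (PP f).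
have fixed := picard_lim_fixed oI iI Ir0 c ca cg P0 dP.
exists (picard_lim a g c P); split=> [b|b x Ix].
  by rewrite -fixed// P0 addr0.
have cl := picard_lim_continuous oI iI Ir0 (c := c) ca cg P0 dP.
(* The limit inherits its derivative from the fixed-point equation, which holds throughout a
   neighbourhood of [x]. *)
apply: near_eq_is_derive _ (is_derive_picard_step c ca cg dP b cl Ix).
near=> y; apply: fixed; near: y; exact: open_nbhs_nbhs.
Unshelve. all: by end_near. Qed.

(** * The round metric in stereographic coordinates *)

Section sphere_metric.
Context {R : realType} {d : nat}.
Implicit Types (y v : 'rV[R]_d).

Lemma differentiable_rV_coord n (f : 'rV[R]_d -> 'rV[R]_n) y :
  (forall k, differentiable (fun z => f z 0 k) y) -> differentiable f y.
Proof.
move=> df.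
have -> : f = \sum_(k < n) (fun z => f z 0 k *: delta_mx 0 k).
  by apply/funext => z; rewrite fct_sumE [LHS]row_sum_delta.
by apply: differentiable_sum => k; apply: differentiableZl.
Qed.

Lemma is_derive_rV_coord k y v : is_derive y v (fun z : 'rV[R]_d => z 0 k : R) (v 0 k).
Proof.
have L (h : R) (x w : 'rV[R]_d) : (h *: w + x) 0 k = h *: w 0 k + x 0 k.
  by rewrite !mxE.
constructor.
  have := @derivable_comp_linear _ _ R^o (fun z : 'rV[R]_d => z 0 k) L id y v.
  by rewrite /comp/= => ->; exact: derivable_id.
have := @derive_comp_linear _ _ R^o (fun z : 'rV[R]_d => z 0 k) L id y v.
by rewrite /comp/= => ->; exact: derive_id.
Qed.

Lemma differentiable_sqnorm y : differentiable (@sqnorm R d) y.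
Proof.
have -> : @sqnorm R d = \sum_(i < d) ((fun z : 'rV[R]_d => z 0 i : R) * (fun z => z 0 i)).
  by apply/funext => z; rewrite fct_sumE; apply: eq_bigr => i _; rewrite expr2.
apply: differentiable_sum => i.
by apply: differentiableM; exact: differentiable_coord.
Qed.

Lemma is_derive_sqnorm y v :
  is_derive y v (@sqnorm R d) (2 * \sum_i y 0 i * v 0 i).
Proof.
have -> : @sqnorm R d = \sum_(i < d) ((fun z : 'rV[R]_d => z 0 i : R) * (fun z => z 0 i)).
  by apply/funext => z; rewrite fct_sumE; apply: eq_bigr => i _; rewrite expr2.
have -> : 2 * (\sum_i y 0 i * v 0 i) =
    \sum_i (y 0 i *: v 0 i + y 0 i *: v 0 i : R).
  by rewrite mulr_sumr; apply: eq_bigr => i _; rewrite /GRing.scale/=; ring.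
apply: is_derive_sum => i.
exact: (is_deriveM (is_derive_rV_coord i y v) (is_derive_rV_coord i y v)).
Qed.

Lemma sqnorm1_gt0 y : 0 < sqnorm y + 1.
Proof. by rewrite ltr_wpDl// sqnorm_ge0. Qed.

Lemma sqnorm1_neq0 y : sqnorm y + 1 != 0.
Proof. by rewrite gt_eqF// sqnorm1_gt0. Qed.

Definition conformal_factor y : R := 2 / (sqnorm y + 1).

Lemma conformal_factor_gt0 y : 0 < conformal_factor y.
Proof. by rewrite divr_gt0// sqnorm1_gt0. Qed.

Lemma differentiable_conformal_factor y : differentiable conformal_factor y.
Proof.
apply: (@differentiableM _ _ (cst 2) (fun y => (sqnorm y + 1)^-1)).
  exact: differentiable_cst.
apply: (@differentiableV _ _ (@sqnorm R d + cst 1)); last exact: sqnorm1_neq0.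
by apply: differentiableD; [exact: differentiable_sqnorm|exact: differentiable_cst].
Qed.

Lemma is_derive_conformal_factor y v : is_derive y v conformal_factor
  (- (4 * \sum_i y 0 i * v 0 i) / (sqnorm y + 1) ^+ 2).
Proof.
have D1 := is_deriveD (is_derive_sqnorm y v) (is_derive_cst (1 : R) y v).
have N0 := sqnorm1_neq0 y.
have D2 : is_derive y v (fun z => (sqnorm z + 1)^-1)
    (- (sqnorm y + 1) ^- 2 *: (2 * \sum_i y 0 i * v 0 i + 0)).
  constructor; first by apply: (@derivableV _ _ (@sqnorm R d + cst 1)) => //; case: D1.
  by have := @deriveV _ _ (@sqnorm R d + cst 1) y v N0; case: D1 => D1 <- -> //.
have := is_deriveZ (2 : R) D2.
have -> : 2 *: (- (sqnorm y + 1) ^- 2 *: (2 * (\sum_i y 0 i * v 0 i) + 0)) =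
    - (4 * \sum_i y 0 i * v 0 i) / (sqnorm y + 1) ^+ 2.
  by rewrite /GRing.scale/=; field.
exact.
Qed.

(** With f the conformal factor, the chart is (± (1 - f), f y), so only the derivative of f has to
    be computed. *)
Lemma stereo_lshift e y k : stereo e y 0 (lshift d k) =
  (-1) ^+ e * (1 - conformal_factor y).
Proof.
rewrite row_mxEl (ord1 k) mxE eqxx mulr1n /conformal_factor.
by congr (_ * _); field; exact: sqnorm1_neq0.
Qed.

Lemma stereo_rshift e y k : stereo e y 0 (rshift 1 k) = conformal_factor y * y 0 k.
Proof. by rewrite row_mxEr mxE. Qed.

Lemma differentiable_stereo e y : differentiable (@stereo R d e) y.
Proof.
apply: differentiable_rV_coord => k.
case: (split_ordP k) => j ->.
  under eq_fun do rewrite stereo_lshift.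
  apply: (@differentiableM _ _ (cst _) (cst 1 - conformal_factor)).
    exact: differentiable_cst.
  apply: differentiableB; first exact: differentiable_cst.
  exact: differentiable_conformal_factor.
under eq_fun do rewrite stereo_rshift.
apply: (@differentiableM _ _ conformal_factor (fun y : 'rV[R]_d => y 0 j : R)).
  exact: differentiable_conformal_factor.
exact: differentiable_coord.
Qed.

(** Vectors are rows, so row [i] of the Jacobian is the i-th coordinate tangent vector and
    ['J *m 'J^T] is the Gram matrix. *)
Lemma jacobian_stereo e y i k :
  'J (@stereo R d e) y i k = 'D_(delta_mx 0 i) (fun z => stereo e z 0 k) y.
Proof.
rewrite mxE -deriveE; last exact: differentiable_stereo.
rewrite derive_mx ?mxE//.
by apply: diff_derivable; exact: differentiable_stereo.
Qed.

Lemma sum_delta_mx y i : \sum_k y 0 k * (delta_mx 0 i : 'rV[R]_d) 0 k = y 0 i.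
Proof.
rewrite (bigD1 i)//= mxE !eqxx mulr1 big1 ?addr0// => k ki.
by rewrite mxE eqxx (negbTE ki) mulr0.
Qed.

(** With f the conformal factor and c = f^2, row l of the Jacobian is (± c y_l, f e_l - c y_l y). In
    the Gram matrix the coefficient of y_i y_j is c (c (1 + |y|^2) - 2 f), which is 0; the sign of
    the pole squares away. *)
Lemma sphere_metricE e y : sphere_metric e y = (conformal_factor y ^+ 2)%:M.
Proof.
apply/matrixP => i j; rewrite [LHS]mxE big_split_ord/= big_ord1 [RHS]mxE.
have N0 := sqnorm1_neq0 y; pose c := 4 / (sqnorm y + 1) ^+ 2.
have Jl l : 'J (@stereo R d e) y l (lshift d 0) = (-1) ^+ e * (c * y 0 l).
  rewrite jacobian_stereo; under eq_fun do rewrite stereo_lshift.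
  have := is_deriveZ ((-1) ^+ e) (is_deriveB (is_derive_cst (1 : R) y (delta_mx 0 l))
    (is_derive_conformal_factor y (delta_mx 0 l))).
  case=> _ ->; rewrite sum_delta_mx /GRing.scale/= /c; congr (_ * _).
  by field.
have Jr l k : 'J (@stereo R d e) y l (rshift 1 k) =
    conformal_factor y * (k == l)%:R - c * y 0 l * y 0 k.
  rewrite jacobian_stereo; under eq_fun do rewrite stereo_rshift.
  have := is_deriveM (is_derive_conformal_factor y (delta_mx 0 l))
    (is_derive_rV_coord k y (delta_mx 0 l)).
  case=> _ ->; rewrite sum_delta_mx /GRing.scale/= /c mxE eqxx /=.
  by field.
rewrite [X in _ * X + _]mxE !Jl.
under eq_bigr do rewrite [X in _ * X]mxE !Jr.
transitivity ((c ^+ 2) * y 0 i * y 0 j + \sum_k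
  (conformal_factor y ^+ 2 * ((k == i)%:R * (k == j)%:R)
   - conformal_factor y * c * y 0 j * ((k == i)%:R * y 0 k)
   - conformal_factor y * c * y 0 i * ((k == j)%:R * y 0 k)
   + c ^+ 2 * y 0 i * y 0 j * y 0 k ^+ 2)).
  congr (_ + _); last by apply: eq_bigr => k _; ring.
  by rewrite mulrACA -expr2 sqrr_sign; ring.
have pick (l : 'I_d) (f : 'I_d -> R) : \sum_k (k == l)%:R * f k = f l.
  rewrite (bigD1 l)//= eqxx mul1r big1 ?addr0// => k kl.
  by rewrite (negbTE kl) mul0r.
rewrite big_split/= sumrB sumrB -!mulr_sumr !pick -/(sqnorm y).
rewrite -mulr_natr /conformal_factor /c.
by field.
Qed.

End sphere_metric.

(** * Laplacians of diagonal metrics, and of the sphere *)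

Section diagonal_metric.
Context {R : realType} {n : nat}.
Implicit Types (g : 'rV[R]_n -> 'M[R]_n) (f : 'rV[R]_n -> R) (x w : 'rV[R]_n).

Lemma gradient_diag g f x w i : g x = diag_mx w -> (forall j, w 0 j != 0) ->
  gradient g f x 0 i = (w 0 i)^-1 * partial i f x.
Proof.
move=> gx w0; pose w' : 'rV[R]_n := \row_j (w 0 j)^-1.
have ww' : diag_mx w *m diag_mx w' = 1%:M.
  rewrite mulmx_diag -diag_const_mx; congr diag_mx.
  by apply/rowP => j; rewrite !mxE divff.
have uw : diag_mx w \in unitmx by case: (mulmx1_unit ww').
have iw : invmx (diag_mx w) = diag_mx w'.
  by rewrite -[LHS]mulmx1 -ww' mulmxA mulVmx// mul1mx.
rewrite mxE gx iw (bigD1 i)//= big1 ?addr0 => [|j ji].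
  by rewrite !mxE eqxx mulr1n.
by rewrite mxE eq_sym (negbTE ji) mulr0n mul0r.
Qed.

Lemma volume_density_diag g x w : g x = diag_mx w ->
  volume_density g x = Num.sqrt (\prod_i w 0 i).
Proof. by move=> gx; rewrite /volume_density gx det_diag. Qed.

End diagonal_metric.

(* The functions need only be related along the two lines, not near the points. *)
Lemma derive_along_line {R : realType} {V W : normedModType R}
    (f : V -> R) (g : W -> R) x v z w (c : R) : derivable g z w ->
  (forall h, f (h *: v + x) = c * g (h *: w + z)) -> 'D_v f x = c * 'D_w g z.
Proof.
move=> dg fg; rewrite -[RHS]/(c *: 'D_w g z) -deriveZ//.
have fx : f x = c * g z by have := fg 0; rewrite !scale0r !add0r.
rewrite /derive (_ : (fun h => _) =
  fun h => h^-1 *: (((c *: g) \o shift z) (h *: w) - (c *: g) z))//.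
by apply/funext => h /=; rewrite fg fx.
Qed.

Section laplacian_sphere.
Context {R : realType} {d : nat}.

Lemma sphere_metric_diag e (y : 'rV[R]_d) :
  sphere_metric e y = diag_mx (const_mx (conformal_factor y ^+ 2)).
Proof. by rewrite sphere_metricE diag_const_mx. Qed.

Lemma laplacian_sphere e (V : 'rV[R]_d -> R) y :
  laplacian (sphere_metric e) V y = (conformal_factor y ^+ d)^-1 *
    \sum_j partial j (fun z : 'rV[R]_d => conformal_factor z ^+ d *
      ((conformal_factor z ^+ 2)^-1 * partial j V z)) y.
Proof.
have vol (z : 'rV[R]_d) : volume_density (sphere_metric e) z = conformal_factor z ^+ d.
  rewrite (volume_density_diag (sphere_metric_diag e z)).
  under eq_bigr do rewrite mxE.
  rewrite prodr_const card_ord exprAC sqrtr_sqr ger0_norm// exprn_ge0//.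
  exact/ltW/conformal_factor_gt0.
rewrite /laplacian /divergence vol; congr (_ * _); apply: eq_bigr => j _.
congr (partial j _ y); apply/funext => z; rewrite vol; congr (_ * _).
rewrite (gradient_diag _ _ (sphere_metric_diag e z)) ?mxE// => k.
by rewrite mxE expf_neq0// gt_eqF// conformal_factor_gt0.
Qed.

End laplacian_sphere.

(** * Separation of variables on the model space *)

Section laplacian_product.
Context {R : realType} (m : nat).
Notation d := m.-1.

Lemma radius_continuous : continuous (@radius R m).
Proof.
move=> x; apply: (@continuous_comp _ _ _ lsubmx (fun M : 'M[R]_1 => M 0 0)).
  exact: continuous_lsubmx.
exact: coord_continuous.
Qed.

Lemma radius_linear h (x v : 'rV[R]_(1 + d)) :
  radius (h *: v + x) = h *: radius v + radius x.
Proof. by rewrite /radius !mxE. Qed.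

Lemma rsubmx_linear h (x v : 'rV[R]_(1 + d)) :
  rsubmx (h *: v + x) = h *: rsubmx v + rsubmx x.
Proof. by rewrite linearP. Qed.

Lemma open_radius (I : set R) : open I -> open [set x | I (@radius R m x)].
Proof. by move=> oI; apply: open_comp => // x _; exact: radius_continuous. Qed.

Lemma smooth_radial_product (I : set R) (u : R -> R) (v : sphere R d -> R) :
  open I -> smooth (I : set R^o) u ->
  (forall e, smooth [set: 'rV[R]_d] (v \o sphere_chart e)) ->
  smooth_on_model I (radial_product u v).
Proof.
move=> oI su sv e.
apply: (@smoothM _ _ _ (u \o @radius R m) ((v \o sphere_chart e) \o rsubmx)).
- exact: open_radius.
- apply: (@smooth_comp_linear _ _ R^o _ _ I) => //; last exact: radius_continuous.
  by move=> h x w; exact: radius_linear.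
have := @smooth_comp_linear _ _ _ rsubmx (fun h x w => rsubmx_linear h x w) setT
  (v \o sphere_chart e) (@continuous_rsubmx _ _ _ _) (sv e).
move=> sT k; have {}sT := sT k.
(* The angular factor is smooth on the whole coordinate space; this restricts it to the part over
   [I]. *)
suff res (V : normedModType R) (U : set V) (f : V -> R) : Ck k setT f -> Ck k U f.
  exact: res.
elim: k f {sT} => [|k IH] f [cf df]; split; try by move=> x _; exact: cf.
  by [].
move=> w; by have [d1 d2] := df w; split=> [x _|]; [exact: d1|exact: IH].
Qed.

Lemma radius_delta0 : radius (delta_mx 0 (lshift d 0) : 'rV[R]_(1 + d)) = 1.
Proof. by rewrite /radius !mxE !eqxx. Qed.

Lemma rsubmx_delta0 : rsubmx (delta_mx 0 (lshift d 0) : 'rV[R]_(1 + d)) = 0.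
Proof. by apply/rowP => j; rewrite !mxE eq_rlshift andbF. Qed.

Lemma radius_delta1 j : radius (delta_mx 0 (rshift 1 j) : 'rV[R]_(1 + d)) = 0.
Proof. by rewrite /radius !mxE eq_lrshift andbF. Qed.

Lemma rsubmx_delta1 j :
  rsubmx (delta_mx 0 (rshift 1 j) : 'rV[R]_(1 + d)) = delta_mx 0 j.
Proof. by apply/rowP => k; rewrite !mxE eq_rshift. Qed.

Lemma partial0_product (A : R -> R) (B : 'rV[R]_d -> R) (x : 'rV[R]_(1 + d)) :
  derivable A (radius x) 1 ->
  partial (lshift d 0) (fun z => A (radius z) * B (rsubmx z)) x =
  'D_1 A (radius x) * B (rsubmx x).
Proof.
move=> dA; rewrite mulrC; apply: derive_along_line => // h.
by rewrite radius_linear rsubmx_linear radius_delta0 rsubmx_delta0 scaler0 add0r mulrC.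
Qed.

Lemma partial1_product j (A : R -> R) (B : 'rV[R]_d -> R) (x : 'rV[R]_(1 + d)) :
  derivable B (rsubmx x) (delta_mx 0 j) ->
  partial (rshift 1 j) (fun z => A (radius z) * B (rsubmx z)) x =
  A (radius x) * partial j B (rsubmx x).
Proof.
move=> dB; apply: derive_along_line => // h.
by rewrite radius_linear rsubmx_linear radius_delta1 rsubmx_delta1 scaler0 add0r.
Qed.

(** Expanded, u'' + d (s'/s) u' - lam u / s^2. The divergence form exhibits the flux s^d u', the
    second unknown of the system that solves the equation. *)
Definition radial_laplacian (s : R -> R) (lam : R) (u : R -> R) (r : R) : R :=
  (s r ^+ d)^-1 * 'D_1 (fun t => s t ^+ d * 'D_1 u t) r - lam / s r ^+ 2 * u r.

Lemma laplacian_product (I : set R) (s u : R -> R) (V : 'rV[R]_d -> R) lam e f :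
  open I -> (forall r, I r -> 0 < s r) -> smooth (I : set R^o) s ->
  smooth (I : set R^o) u -> smooth setT V ->
  (forall y, laplacian (sphere_metric e) V y = - lam * V y) ->
  (forall x, I (radius x) -> f x = u (radius x) * V (rsubmx x)) ->
  forall x, I (radius x) -> laplacian (model_metric s e) f x =
    radial_laplacian s lam u (radius x) * V (rsubmx x).
Proof.
move=> oI s0 ss su sV lapV fE x Ix.
have oU := open_radius oI.
pose w (z : 'rV[R]_(1 + d)) : 'rV[R]_(1 + d) :=
  row_mx (const_mx 1) (const_mx (s (radius z) ^+ 2 * conformal_factor (rsubmx z) ^+ 2)).
have metricE z : model_metric s e z = diag_mx (w z).
  by rewrite diag_mx_row !diag_const_mx /model_metric sphere_metricE scale_scalar_mx.
have cf0 (y : 'rV[R]_d) : conformal_factor y != 0 by rewrite gt_eqF// conformal_factor_gt0.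
have w0 z : I (radius z) -> forall j, w z 0 j != 0.
  move=> Iz j; case: (split_ordP j) => k ->; rewrite ?row_mxEl ?row_mxEr mxE ?oner_neq0//.
  by rewrite mulf_neq0// expf_neq0// gt_eqF// s0.
have vol (z : 'rV[R]_(1 + d)) : I (radius z) ->
    volume_density (model_metric s e) z = s (radius z) ^+ d * conformal_factor (rsubmx z) ^+ d.
  move=> Iz; rewrite (volume_density_diag (metricE z)) big_split_ord /= big_ord1.
  rewrite row_mxEl mxE mul1r; under eq_bigr do rewrite row_mxEr mxE.
  rewrite prodr_const card_ord -exprMn exprAC sqrtr_sqr -[RHS]exprMn ger0_norm//.
  by rewrite exprn_ge0// mulr_ge0// ltW ?s0 ?conformal_factor_gt0.
have du r : I r -> derivable u r 1 by move=> Ir; exact: Ck_derivable (su 1) Ir.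
have dV j y : derivable V y (delta_mx 0 j) by exact: Ck_derivable (sV 1) _.
have grad0 z : I (radius z) ->
    gradient (model_metric s e) f z 0 (lshift d 0) = 'D_1 u (radius z) * V (rsubmx z).
  move=> Iz; rewrite (gradient_diag _ _ (metricE z)); last exact: w0.
  rewrite row_mxEl mxE invr1 mul1r -partial0_product; last exact: du.
  exact: (@eq_on_derive _ _ [set z | I (radius z)]).
have grad1 j z : I (radius z) -> gradient (model_metric s e) f z 0 (rshift 1 j) =
    (s (radius z) ^+ 2 * conformal_factor (rsubmx z) ^+ 2)^-1 *
    (u (radius z) * partial j V (rsubmx z)).
  move=> Iz; rewrite (gradient_diag _ _ (metricE z)); last exact: w0.
  rewrite row_mxEr mxE -partial1_product; last exact: dV.
  congr (_ * _); exact: (@eq_on_derive _ _ [set z | I (radius z)]).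
have main0 : partial (lshift d 0) (fun z => volume_density (model_metric s e) z *
      gradient (model_metric s e) f z 0 (lshift d 0)) x =
    'D_1 (fun t => s t ^+ d * 'D_1 u t) (radius x) *
    (conformal_factor (rsubmx x) ^+ d * V (rsubmx x)).
  rewrite -[RHS](@partial0_product (fun t => s t ^+ d * 'D_1 u t)
    (fun y : 'rV[R]_d => conformal_factor y ^+ d * V y)).
    apply: (@eq_on_derive _ _ [set z | I (radius z)]) => // z Iz.
    by rewrite vol// grad0//; ring.
  have sdu : smooth (I : set R^o) ('D_1 u) by move=> n; exact: Ck_derive (su n.+1).
  exact: (Ck_derivable (smoothM (oI : open (I : set R^o)) (smoothX d oI ss) sdu 1)).
(* The radial factors come out and leave the j-th term of the sphere Laplacian. The quotient of
   powers of s stays unsimplified, since d - 2 is negative for m = 2. *)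
have main1 j : partial (rshift 1 j) (fun z => volume_density (model_metric s e) z *
      gradient (model_metric s e) f z 0 (rshift 1 j)) x =
    s (radius x) ^+ d / s (radius x) ^+ 2 * u (radius x) *
    partial j (fun y : 'rV[R]_d => conformal_factor y ^+ d *
      ((conformal_factor y ^+ 2)^-1 * partial j V y)) (rsubmx x).
  rewrite -[RHS](@partial1_product j (fun t => s t ^+ d / s t ^+ 2 * u t)).
    apply: (@eq_on_derive _ _ [set z | I (radius z)]) => // z Iz.
    by rewrite vol// grad1// invfM; ring.
  have dcf : differentiable (@conformal_factor R d) (rsubmx x).
    exact: differentiable_conformal_factor.
  have dX n : derivable (fun y => conformal_factor y ^+ n) (rsubmx x) (delta_mx 0 j).
    by have := @derivableX _ _ _ n _ _ (diff_derivable dcf); rewrite exprfctE.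
  have dVj : derivable (partial j V) (rsubmx x) (delta_mx 0 j).
    by apply: (@Ck_derivable _ _ 0 setT _ _ _ (@Ck_derive _ _ 1 setT V (delta_mx 0 j) (sV 2))).
  have dX2 : derivable (fun y => (conformal_factor y ^+ 2)^-1) (rsubmx x) (delta_mx 0 j).
    apply: (@derivableV _ _ (fun y : 'rV[R]_d => conformal_factor y ^+ 2) _ _ _ (dX 2)).
    by rewrite expf_neq0.
  exact: (derivableM (dX d) (derivableM dX2 dVj)).
have := lapV (rsubmx x); rewrite laplacian_sphere => lapE.
rewrite /laplacian /divergence vol// big_split_ord /= big_ord1 main0.
under eq_bigr do rewrite main1.
rewrite -mulr_sumr.
set S := \sum_(j < d) _ in lapE *.
have cfd : conformal_factor (rsubmx x) ^+ d != 0 :> R by rewrite expf_neq0.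
(* Up to the sphere's volume density, the angular sum is the sphere Laplacian of [V], which the
   eigenvalue equation evaluates. *)
have -> : S = conformal_factor (rsubmx x) ^+ d * (- lam * V (rsubmx x)).
  by rewrite -lapE mulrA divff// mul1r.
have sx0 : s (radius x) != 0 by rewrite gt_eqF// s0.
have sxd : s (radius x) ^+ d != 0 by rewrite expf_neq0.
rewrite /radial_laplacian.
move: sxd cfd; move: (s (radius x) ^+ d) (conformal_factor (rsubmx x) ^+ d) => a b a0 b0.
by field; rewrite a0 b0 sx0.
Qed.

End laplacian_product.

Lemma radial_solution {R : realType} (m : nat) (I : set R) (r0 : R) (s f : R -> R)
    (lam c : R) :
  open I -> is_interval I -> I r0 -> (forall r, I r -> 0 < s r) ->
  smooth (I : set R^o) s -> smooth (I : set R^o) f ->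
  exists u : R -> R, [/\ smooth (I : set R^o) u, u r0 = c &
    forall r, I r -> radial_laplacian m s lam u r = f r].
Proof.
move=> oI iI Ir0 s0 ss sf; set d := m.-1.
have sn0 n r : I r -> s r ^+ n != 0 by move=> Ir; rewrite expf_neq0// gt_eqF// s0.
have sX n := smoothX n (oI : open (I : set R^o)) ss.
(* The system for y true = u and y false = s^d u'. *)
pose a b r := if b then (s r ^+ d)^-1 else lam / s r ^+ 2 * s r ^+ d.
pose g b r := if b then 0 else s r ^+ d * f r.
have sa b : smooth (I : set R^o) (a b).
  case: b; first exact: smoothV oI (@sn0 d) (sX d).
  apply: (smoothM oI _ (sX d)); apply: (smoothM oI (smooth_cst _ lam)).
  exact: smoothV oI (@sn0 2) (sX 2).
have sg b : smooth (I : set R^o) (g b).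
  by case: b; [exact: smooth_cst|exact: smoothM oI (sX d) sf].
(* The initial flux 0, that is u'(r0) = 0, is an arbitrary normalisation. *)
have [y [y0 dy]] := linear_system_exists (fun b : bool => if b then c else 0) oI iI Ir0
  (fun b r Ir => Ck_continuous (sa b 0) Ir) (fun b r Ir => Ck_continuous (sg b 0) Ir).
exists (y true); split; first exact: (smooth_system oI sa sg dy).
  exact: y0.
move=> r Ir; rewrite /radial_laplacian -/d.
(* The first equation of the system identifies its second unknown as the flux; the second equation
   then becomes L u = f. *)
have flux t : I t -> y false t = s t ^+ d * 'D_1 (y true) t.
  move=> It; have [_ ->] := dy true t It.
  by rewrite /a /g addr0 mulrA divff ?mul1r// sn0.
rewrite -(eq_on_derive (V := R^o) 1 oI Ir flux); have [_ ->] := dy false r Ir.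
by rewrite /a /g /=; field; rewrite !sn0//= gt_eqF// s0.
Qed.

(** * Proper biharmonic products from one eigenfunction *)

Section eigenfunction_products.
Context {R : realType} (m k : nat) (v : sphere R m.-1 -> R).
Hypothesis ev : eigenfunction m k v.
Variables (I : set R) (r0 : R) (s : R -> R).
Hypotheses (oI : open I) (iI : is_interval I) (Ir0 : I r0)
  (s0 : forall r, I r -> 0 < s r) (ss : smooth (I : set R^o) s).
Notation lam := (k%:R * (m%:R + k%:R - 2) : R).

Lemma proper_biharmonic_product (u w : R -> R) :
  smooth (I : set R^o) u -> smooth (I : set R^o) w -> w r0 != 0 ->
  (forall r, I r -> radial_laplacian m s lam u r = w r) ->
  (forall r, I r -> radial_laplacian m s lam w r = 0) ->
  proper_biharmonic m I s (radial_product u v).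
Proof.
move=> su sw w0 Lu Lw; have [[z vz] sph] := ev.
have sv e := (sph e).1; have lapV e := (sph e).2.
have sp := smooth_radial_product oI su sv.
have lap e x : I (radius x) ->
    laplacian (model_metric s e) (radial_product u v \o model_chart e) x =
    w (radius x) * v (sphere_chart e (rsubmx x)).
  by move=> Ix; rewrite (laplacian_product oI s0 ss su (sv e) (lapV e))// Lu.
split; first split=> // e x Ix.
  (* Second separation of variables, now for the function Delta (u v), which [lap] identifies with w
     v over [I] only. *)
  by rewrite (laplacian_product oI s0 ss sw (sv e) (lapV e) (lap e))// Lw// mul0r.
case=> _ har; have [e [y yz]] := sphere_chart_cover z.
pose x : 'rV[R]_(1 + m.-1) := row_mx r0%:M y.
have rx : radius x = r0 by rewrite /radius row_mxKl mxE eqxx mulr1n.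
have := har e x; rewrite lap rx// row_mxKr yz => /(_ Ir0)/eqP.
by rewrite mulf_eq0 (negbTE w0) (negbTE vz).
Qed.

Lemma proper_biharmonic_product_exists (c : R) :
  exists u : R -> R, [/\ smooth (I : set R^o) u, u r0 = c &
    proper_biharmonic m I s (radial_product u v)].
Proof.
have [w [sw w0 Lw]] := radial_solution m lam 1 oI iI Ir0 s0 ss (smooth_cst _ 0).
have [u [su u0 Lu]] := radial_solution m lam c oI iI Ir0 s0 ss sw.
exists u; split=> //; apply: (proper_biharmonic_product su sw) => //.
by rewrite w0 oner_neq0.
Qed.

Lemma infinite_proper_biharmonic_products :
  infinite_set (proper_biharmonic_products m I s v).
Proof.
have [[z vz] _] := ev.
have [u uP] := choice (fun n : nat => proper_biharmonic_product_exists n%:R).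
pose p n := (radial_product (u n) v \_ (I `*` [set: sphere R m.-1]))%FUN.
(* As [r0] lies in [I], restriction keeps this value, and [v z != 0] lets [n] be recovered from
   it. *)
have pE n : p n (r0, z) = n%:R * v z.
  rewrite /p patchT; last by rewrite inE.
  by have [_ u0 _] := uP n; rewrite /radial_product /= u0.
apply: (@sub_infinite_set _ (range p)).
  by move=> _ [n _ <-]; exists (u n) => //; have [su _ pu] := uP n.
have pinj : injective p.
  move=> n n' /(congr1 (fun q => q (r0, z))); rewrite !pE => /(mulIf vz)/eqP.
  by rewrite eqr_nat => /eqP.
by rewrite (eq_finite_set (inj_card_eq _)); [exact: infinite_nat|
  by move=> ? ? _ _; exact: pinj].
Qed.

End eigenfunction_products.

(** * Smoothness of the warping functions of the space forms *)

Section space_forms.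
Context {R : realType}.
Implicit Types U : set R.

Lemma smooth_id U : open U -> smooth (U : set R^o) (fun r : R => r).
Proof.
move=> oU; apply: (smooth_primitive oU _ (smooth_cst _ 1)) => x _.
Qed.

(** Sine and cosine solve a crosswise linear system with constant coefficients, so bootstrapping
    applies to the pair. *)
Lemma smooth_sin U : open U -> smooth (U : set R^o) (@sin R).
Proof.
move=> oU.
apply: (@smooth_system _ U (fun b : bool => if b then @sin R else @cos R)
  (fun b => cst (if b then 1 else -1)) (fun=> cst 0) oU _ _ _ true) => [b|b|b x _];
  try exact: smooth_cst.
rewrite addr0; case: b => /=; first by rewrite mul1r; exact: is_derive_sin.
by rewrite mulN1r; exact: is_derive_cos.
Qed.

Lemma smooth_sinh U : open U -> smooth (U : set R^o) (@sinh R).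
Proof.
(* [e true] is sinh and [e false] is cosh; each is the derivative of the other. *)
move=> oU; pose e (b : bool) (r : R) : R := 2^-1 * (expR r + (-1) ^+ b * expR (- r)).
have -> : @sinh R = e true.
  by apply/funext => r; rewrite /e mulN1r mulrC.
apply: (@smooth_system _ U e (fun=> cst 1) (fun=> cst 0) oU) => [b|b|b x _];
  try exact: smooth_cst.
have dN : is_derive x 1 (fun r : R => expR (- r)) (expR (- x) * -1).
  by apply: (@is_derive1_comp _ expR -%R).
have := is_deriveZ (2^-1 : R) (is_deriveD (is_derive_expR x) (is_deriveZ ((-1) ^+ b : R) dN)).
rewrite (_ : 2^-1 *: _ = cst 1 x * e (~~ b) x + cst 0 x); first exact.
by rewrite /e signrN /GRing.scale/=; ring.
Qed.

End space_forms.

Theorem theorem4p1 (R : realType) (m : nat) (hm : (2 <= m)%N) :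
  (forall s : R -> R,
     smooth (`]0, +oo[ : set R^o) s ->
     (forall r, 0 < r -> 0 < s r) ->
     forall (k : nat) (v : sphere R m.-1 -> R), eigenfunction m k v ->
     exists u : R -> R,
       smooth (`]0, +oo[ : set R^o) u /\
       proper_biharmonic m `]0, +oo[ s (radial_product u v)) /\
  (forall (k : nat) (v : sphere R m.-1 -> R), eigenfunction m k v ->
     infinite_set (proper_biharmonic_products m `]0, +oo[ (fun r => r) v) /\
     infinite_set (proper_biharmonic_products m `]0, +oo[ (@sinh R) v) /\
     infinite_set (proper_biharmonic_products m `]0, pi[ (@sin R) v)).
Proof.
have opos : open (`]0, +oo[%classic : set R) by exact: interval_open.
have ipos : is_interval (`]0, +oo[%classic : set R) by exact: interval_is_interval.
have pos1 : `]0, +oo[%classic (1 : R) by rewrite /= in_itv/= ltr01.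
have posE (r : R) : `]0, +oo[%classic r -> 0 < r by rewrite /= in_itv/= andbT.
split=> [s ss s0 k v ev|k v ev].
  have s0' r : `]0, +oo[%classic r -> 0 < s r by move=> /posE; exact: s0.
  (* The choice u(1) = 0 is harmless: what makes the product non-harmonic is w(1) = 1. *)
  have [u [su _ pu]] := proper_biharmonic_product_exists ev opos ipos pos1 s0' ss 0.
  by exists u.
split; last split.
- exact: (infinite_proper_biharmonic_products ev opos ipos pos1 posE (smooth_id opos)).
- apply: (infinite_proper_biharmonic_products ev opos ipos pos1 _ (smooth_sinh opos)).
  move=> r /posE r0; rewrite /sinh divr_gt0// subr_gt0 ltr_expR.
  by rewrite (lt_trans _ r0)// oppr_lt0.
have opi : open (`]0, pi[%classic : set R) by exact: interval_open.
have ipi : is_interval (`]0, pi[%classic : set R) by exact: interval_is_interval.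
have pi2 : `]0, pi[%classic (pi / 2 : R).
  by rewrite /= in_itv/= divr_gt0 ?pi_gt0//= ltr_pdivrMr// ltr_pMr ?pi_gt0// ltr1n.
apply: (infinite_proper_biharmonic_products ev opi ipi pi2 _ (smooth_sin opi)).
by move=> r /=; rewrite in_itv/=; exact: sin_gt0_pi.
Qed.
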